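(* Suppose that $(K,|\cdot|_K)$ is a $p$-adic field and view $K^n$ as the measurable space equipped with the $\sigma$-algebra of all Borel subsets. Let $r\in\mathbf Q_{>0}$. Let $F=(f_1,\dots,f_n):X\to K^n$ and $G=(g_1,\dots,g_n):Y\to K^n$ be any measurable maps from measured spaces $(X,\mathfrak A,\mu)$ and $(Y,\mathfrak B,\nu)$ to $K^n$. If $$f_i\in\mathcal L^1(X,\mathfrak A,\mu)\quad\text{and}\quad g_i\in\mathcal L^1(Y,\mathfrak B,\nu)\quad\text{for } i=1,\dots,n,$$ and $$\int_X\big|1+v_1f_1(x)+\cdots+v_nf_n(x)\big|_K^r\,d\mu(x)=\int_Y\big|1+v_1g_1(y)+\cdots+v_ng_n(y)\big|_K^r\,d\nu(y)$$ for every $(v_1,\dots,v_n)\in K^n$, then $F$ and $G$ are equimeasurable.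
   Context: A $p$-adic field $K$ is a completion of an algebraic number field at a prime divisor, whose residue field $\mathbf F_q$ has $q$ a power of the prime number $p$; $|\cdot|_K$ is a fixed non-archimedean absolute value on $K$ compatible with the valuation on its ring of integers. For a $K$-valued measurable function $f$ on a measured space $(X,\mathfrak A,\mu)$, $f\in\mathcal L^1(X,\mathfrak A,\mu)$ means $\int_X|f|_K\,d\mu<\infty$. Measurable maps $F:X\to Z$ and $G:Y\to Z$ from measured spaces $(X,\mathfrak A,\mu)$ and $(Y,\mathfrak B,\nu)$ to a measurable space $(Z,\mathfrak C)$ are called equimeasurable if $F_*\mu=G_*\nu$, i.e. $\mu\big(F^{-1}(C)\big)=\nu\big(G^{-1}(C)\big)$ for every $C\in\mathfrak C$.
   Formalization: The equality of integrals is read between finite numbers: the integrals are assumed finite for every v. If infinite values were allowed, the claim would fail, e.g. for Lebesgue measure on R with F = 0 and G the indicator of [0,1]. *)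

(* Defs.v *)
From HB Require Import structures.
From mathcomp Require Import all_boot all_order all_algebra all_field.
From mathcomp Require Import all_classical all_reals all_analysis.

Set Implicit Arguments.
Unset Strict Implicit.
Unset Printing Implicit Defensive.

Import Order.TTheory GRing.Theory Num.Theory.
Import numFieldNormedType.Exports.

Local Open Scope classical_set_scope.
Local Open Scope ring_scope.

(* The norms of the library cannot serve here: their axioms demand
   `|x *+ n| = `|x| *+ n, which is the archimedean behaviour. *)
Record ultrametric_abs (R : realType) (K : fieldType) := UltrametricAbs {
  absv :> K -> R ;
  absv_ge0 : forall x, 0 <= absv x ;
  absv_eq0 : forall x, absv x = 0 <-> x = 0 ;
  absvM : forall x y, absv (x * y) = absv x * absv y ;
  absvD : forall x y, absv (x + y) <= Num.max (absv x) (absv y)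
}.

(* K with the topology of the distance |x - y| *)
Definition valued_field (R : realType) (K : fieldType)
  (abs : ultrametric_abs R K) : Type := K.

Section ValuedField.
Variables (R : realType) (K : fieldType) (abs : ultrametric_abs R K).

Definition absv_dist (x y : valued_field abs) : R := abs ((x : K) - (y : K)).

Lemma absv1 : abs 1 = 1.
Proof.
have n0 : abs 1 != 0.
  by apply/eqP => /absv_eq0/eqP; rewrite oner_eq0.
by apply: (mulfI n0); rewrite -absvM !mulr1.
Qed.

Lemma absvN x : abs (- x) = abs x.
Proof.
suff -> : abs (- x) = abs (- 1) * abs x.
  suff -> : abs (- 1) = 1 by rewrite mul1r.
  apply/eqP; rewrite -(@pexpr_eq1 _ _ 2) ?absv_ge0//.
  by rewrite expr2 -absvM mulrNN mulr1 absv1.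
by rewrite -absvM mulN1r.
Qed.

Lemma absv_distxx x : absv_dist x x = 0.
Proof. by rewrite /absv_dist subrr; apply/absv_eq0. Qed.

Lemma absv_dist_eq0 x y : absv_dist x y = 0 -> x = y.
Proof. by move=> /absv_eq0/subr0_eq. Qed.

Lemma absv_distC x y : absv_dist x y = absv_dist y x.
Proof. by rewrite /absv_dist -absvN opprB. Qed.

Lemma absv_dist_triangle y x z :
  absv_dist x z <= absv_dist x y + absv_dist y z.
Proof.
rewrite /absv_dist -(subrKA (y : K)); apply: le_trans (absvD _ _ _) _.
by rewrite ge_max lerDl lerDr !absv_ge0.
Qed.

HB.instance Definition _ := GRing.Field.on (valued_field abs).
HB.instance Definition _ := isPointed.Build (valued_field abs) 0.
HB.instance Definition _ := isMetric.Build R (valued_field abs)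
  absv_distxx absv_dist_eq0 absv_distC absv_dist_triangle.

End ValuedField.

Section NumberField.
Variable L : fieldExtType rat.

Definition ring_of_integers : set L :=
  [set a | integralOver (intr : int -> L) a].

(* A prime divisor is given by a nonzero prime ideal of the ring of integers. *)
Record prime_divisor (P : set L) : Prop := PrimeDivisor {
  pdiv_sub : P `<=` ring_of_integers ;
  pdiv_0 : P 0 ;
  pdivB : forall a b, P a -> P b -> P (a - b) ;
  pdivM : forall a b, ring_of_integers a -> P b -> P (a * b) ;
  pdiv_proper : ~ P 1 ;
  pdiv_prime : forall a b, ring_of_integers a -> ring_of_integers b ->
    P (a * b) -> P a \/ P b ;
  pdiv_neq0 : exists2 a, P a & a != 0
}.

Fixpoint ideal_exp (P : set L) (k : nat) : set L :=
  if k is k'.+1 then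
    [set a | exists2 s : seq (L * L),
        forall u, u \in s -> P u.1 /\ ideal_exp P k' u.2
      & a = \sum_(u <- s) u.1 * u.2]
  else ring_of_integers.

(* v_P(a) = k, for a in the ring of integers *)
Definition has_valuation (P : set L) (a : L) (k : nat) : Prop :=
  ideal_exp P k a /\ ~ ideal_exp P k.+1 a.

End NumberField.

Section PadicField.
Variables (R : realType) (K : fieldType) (abs : ultrametric_abs R K).

(* K is the completion of L at P: K is complete, L is dense in K, and on
   the integers of L (whose fractions exhaust L) the absolute value of K is
   c ^ v_P for some constant 0 < c < 1. *)
Definition is_completion_at (L : fieldExtType rat) (P : set L) : Prop :=
  (forall F : set_system (valued_field abs), ProperFilter F ->
     cauchy F -> exists x : valued_field abs, F --> x) /\
  exists iota : {rmorphism L -> K},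
    dense (range iota : set (valued_field abs)) /\
    exists2 c : R, 0 < c < 1 &
      forall a, ring_of_integers a -> a != 0 ->
        exists2 k, has_valuation P a k & abs (iota a) = c ^+ k.

(* The residue field {x | |x| <= 1} / {x | |x| < 1} has q elements: F is
   this quotient, and red is the reduction map (its values are irrelevant
   outside of the ring of integers of K). *)
Definition residue_field_card (q : nat) : Prop :=
  exists (F : finFieldType) (red : K -> F),
    [/\ #|F| = q, red 1 = 1,
      forall x y, abs x <= 1 -> abs y <= 1 ->
        red (x + y) = red x + red y /\ red (x * y) = red x * red y,
      forall z, exists2 x, abs x <= 1 & red x = z
    & forall x, abs x <= 1 -> (red x = 0 <-> abs x < 1)].

Definition padic_field (p : nat) : Prop :=
  [/\ prime p,
    exists (L : fieldExtType rat) (P : set L),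
      prime_divisor P /\ is_completion_at P
  & exists2 f : nat, (0 < f)%N & residue_field_card (p ^ f)].

(* K ^ n with its Borel sigma-algebra *)
Definition borel_space (n : nat) :=
  g_sigma_algebraType (@open 'rV[valued_field abs]_n).

(* The measurability of f, which goes with this condition, is left apart. *)
Definition L1 d (X : measurableType d) (mu : {measure set X -> \bar R})
    (f : X -> K) : Prop :=
  (\int[mu]_x (abs (f x))%:E < +oo)%E.

End PadicField.

Definition equimeasurable (R : realType) d1 d2 d3
    (X : measurableType d1) (Y : measurableType d2) (Z : measurableType d3)
    (mu : {measure set X -> \bar R}) (nu : {measure set Y -> \bar R})
    (F : X -> Z) (G : Y -> Z) : Prop :=
  forall C, measurable C -> pushforward mu F C = pushforward nu G C.

(* Main.v *)
(* Let O be the ring of integers of K and pi a uniformizer. For w in K^(n+1)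
   with M = max |w_j|, let u range over a system of representatives of
   (O / pi^N)^(n+1). Averaging |u . w|^r over the coordinate of u facing an
   entry of maximal absolute value gives a constant A_N >= 1 times M^r, up to
   an error |pi|^(N r) M^r coming from the single class of that coordinate for
   which u . w is divisible by pi^N. For w = (pi^k, x - c) the averaged
   functions are of the form |t + v . x|^r, whose integrals are known, so
   letting N grow determines the integral of max(|pi|^k, |x - c|)^r. Two
   consecutive values of k differ by a multiple of the measure of the polydisc
   of center c and radius |pi|^(k+1), and polydiscs form a pi-system generating
   the Borel sets. *)
Require Import Defs.
From mathcomp Require Import all_boot all_order all_algebra all_field.
From mathcomp Require Import all_classical all_reals all_analysis.
From mathcomp Require Import measurable_realfun zify ring lra.

Set Implicit Arguments.
Unset Strict Implicit.
Unset Printing Implicit Defensive.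

Import Order.TTheory GRing.Theory Num.Theory.
Import numFieldNormedType.Exports.

Local Open Scope classical_set_scope.
Local Open Scope ring_scope.

(** * Valuation of a p-adic field *)

Section UltrametricAbs.
Variables (R : realType) (K : fieldType) (abs : ultrametric_abs R K).
Implicit Types x y : K.

Lemma absv0 : abs 0 = 0.
Proof. exact/absv_eq0. Qed.

Lemma absv_gt0 x : (0 < abs x) = (x != 0).
Proof.
rewrite lt_def absv_ge0 andbT; congr negb.
by apply/eqP/eqP => [/absv_eq0|->]; rewrite ?absv0.
Qed.

Lemma absvX x k : abs (x ^+ k) = abs x ^+ k.
Proof. by elim: k => [|k IH]; rewrite ?absv1// !exprS absvM IH. Qed.

Lemma absvV x : abs x^-1 = (abs x)^-1.
Proof.
have [->|x0] := eqVneq x 0; first by rewrite invr0 absv0 invr0.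
have ax0 : abs x != 0 by rewrite gt_eqF// absv_gt0.
by apply: (mulfI ax0); rewrite -absvM !mulfV// absv1.
Qed.

Lemma absvD_le (e : R) x y : abs x <= e -> abs y <= e -> abs (x + y) <= e.
Proof. by move=> xe ye; rewrite (le_trans (absvD _ _ _))// ge_max xe ye. Qed.

Lemma absvB_le (e : R) x y : abs x <= e -> abs y <= e -> abs (x - y) <= e.
Proof. by move=> xe ye; apply: absvD_le; rewrite ?absvN. Qed.

Lemma absvDr x y : abs x < abs y -> abs (x + y) = abs y.
Proof.
move=> xy; apply/le_anti; rewrite absvD_le//= ?(ltW xy)//=.
have := absvD abs (x + y) (- x); rewrite (addrC x) addrK absvN le_max.
by rewrite (leNgt _ (abs x)) xy orbF addrC.
Qed.

Lemma absv_sum_le (I : Type) (s : seq I) (P : pred I) (f : I -> K) (e : R) :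
  0 <= e -> (forall i, P i -> abs (f i) <= e) ->
  abs (\sum_(i <- s | P i) f i) <= e.
Proof.
move=> e0 fe; apply: (big_ind (fun x => abs x <= e)) => //.
- by rewrite absv0.
- by move=> x y; exact: absvD_le.
Qed.

End UltrametricAbs.

Lemma intr_algE (L : fieldExtType rat) (z : int) :
  (z%:~R : L) = (z%:~R : rat)%:A.
Proof. exact/esym/(rmorph_int (in_alg L)). Qed.

Lemma intr_alg_eq0 (L : fieldExtType rat) (z : int) :
  ((z%:~R : L) == 0) = (z == 0).
Proof. by rewrite intr_algE scaler_eq0 oner_eq0 orbF intr_eq0. Qed.

(** Clearing denominators in the minimal polynomial of [x] gives an integer polynomial [f] vanishing
    at [x]; its leading coefficient serves as [m]. *)
Lemma number_field_denominator (L : fieldExtType rat) (x : L) :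
  exists2 m : int, m != 0 & integralOver (intr : int -> L) (m%:~R * x).
Proof.
have [f f0 fx] : exists2 f : {poly int},
    f != 0 & root (map_poly (intr : int -> L) f) x.
  have /polyOver1P[q qE] := minPolyOver 1 x.
  have [f [a a0 fE]] := rat_poly_scale q.
  exists f.
    apply/eqP => f0; have := monic_neq0 (monic_minPoly 1 x).
    by rewrite qE fE f0 rmorph0 scaler0 rmorph0 eqxx.
  have := minPolyxx 1 x; rewrite qE fE -mul_polyC rmorphM/= map_polyC/=.
  rewrite hornerM hornerC => /eqP; rewrite mulf_eq0 => /orP[|].
    by rewrite scaler_eq0 oner_eq0 orbF invr_eq0 intr_eq0 (negPf a0).
  rewrite /root -map_poly_comp/= => /eqP <-.
  by apply/eqP; congr (_.[_]); apply: eq_map_poly => z /=; rewrite intr_algE.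
set m := lead_coef f; have m0 : m != 0 by rewrite lead_coef_eq0.
exists m => //.
have [d fd] : exists d, size f = d.+2.
  case sf : (size f) => [|[|d]]; last by exists d.
  - by move/eqP: sf; rewrite size_poly_eq0 (negPf f0).
  - move/eqP/size_poly1P: sf fx => [c c0 ->].
    by rewrite map_polyC/= rootC intr_alg_eq0 (negPf c0).
(* With d + 1 the degree of [f], this monic integer polynomial satisfies g(m X) = m^d f(X). *)
pose g := 'X^(d.+1) + \poly_(i < d.+1) (f`_i * m ^+ (d - i)).
have sg : (size (\poly_(i < d.+1) (f`_i * m ^+ (d - i)))%R <
    size ('X^(d.+1) : {poly int}))%N.
  by rewrite size_polyXn ltnS size_poly.
exists g; first by rewrite monicE lead_coefDl// lead_coefXn.
rewrite /root rmorphD/= map_polyXn hornerD hornerXn.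
have -> : (map_poly intr (\poly_(i < d.+1) (f`_i * m ^+ (d - i)))).[m%:~R * x] =
    \sum_(i < d.+1) (f`_i * m ^+ (d - i))%:~R * (m%:~R * x) ^+ i :> L.
  rewrite poly_def rmorph_sum/= horner_sum; apply: eq_bigr => i _.
  by rewrite map_polyZ/= hornerZ map_polyXn hornerXn.
have -> : (m%:~R * x) ^+ d.+1 = m%:~R ^+ d * (m%:~R * x ^+ d.+1) :> L.
  by rewrite exprMn exprSr -mulrA.
have -> : \sum_(i < d.+1) (f`_i * m ^+ (d - i))%:~R * (m%:~R * x) ^+ i =
    m%:~R ^+ d * \sum_(i < d.+1) (f`_i)%:~R * x ^+ i :> L.
  rewrite mulr_sumr; apply: eq_bigr => i _.
  have -> : m%:~R ^+ d = m%:~R ^+ (d - i) * m%:~R ^+ i :> L.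
    by rewrite -exprD subnK// -ltnS.
  by rewrite exprMn rmorphM/= rmorphXn/=; ring.
rewrite -mulrDr mulf_eq0; apply/orP; right.
move: fx; rewrite /root horner_coef size_map_poly_id0 ?intr_alg_eq0// fd.
have fm : f`_d.+1 = m by rewrite /m lead_coefE fd.
rewrite big_ord_recr/= addrC coef_map/= fm.
by under eq_bigr do rewrite coef_map/=.
Qed.

(** * Uniformizer and residue classes of the completion *)

Section Completion.
Variables (R : realType) (K : fieldType) (abs : ultrametric_abs R K).

Lemma dense_approx (S : set (valued_field abs)) (x : K) (e : R) :
  dense S -> 0 < e -> exists2 y : K, S y & abs (x - y) < e.
Proof.
move=> dS e0; have := dS ((ball (x : valued_field abs) e)^°).
case; [|exact: open_interior|].
  exists x; rewrite /interior; exact: nbhsx_ballx.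
move=> y [yx Sy]; exists y => //.
by move: yx => /interior_subset; rewrite ballEmdist.
Qed.

(** An element of L closer to [x] than |x| has the same absolute value, and it is a quotient of two
    integers of L. The shape |x| c^i = c^j avoids negative exponents. *)
Lemma completion_values (L : fieldExtType rat) (iota : {rmorphism L -> K})
    (c : R) : dense (range iota : set (valued_field abs)) ->
  (forall a, ring_of_integers a -> a != 0 ->
     exists k, abs (iota a) = c ^+ k) ->
  forall x, x != 0 -> exists i j, abs x * c ^+ i = c ^+ j.
Proof.
move=> dI val x x0.
have [_ [a _ <-] xa] := @dense_approx _ x (abs x) dI ltac:(by rewrite absv_gt0).
have ax : abs (iota a) = abs x.
  by rewrite -(subrK x (iota a)) absvDr// -absvN opprB.
have a0 : a != 0.
  by rewrite -(fmorph_eq0 iota) -(absv_gt0 abs) ax absv_gt0.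
have [m m0 ma] := number_field_denominator a.
have [|i mi] := val m%:~R _ ltac:(by rewrite intr_alg_eq0).
  exact: integral_id.
have [|j maj] := val (m%:~R * a) ma.
  by rewrite mulf_neq0// intr_alg_eq0.
by exists i, j; rewrite -mi -maj -ax rmorphM absvM mulrC.
Qed.

(** Absolute values strictly between 0 and 1 are powers of [c] with positive exponent, so the
    smallest exponent that occurs gives a largest value below 1. *)
Lemma padic_uniformizer p : padic_field abs p ->
  exists2 pi : K, 0 < abs pi < 1 & forall x, abs x < 1 -> abs x <= abs pi.
Proof.
move=> [_ [L [P [hP [_ [iota [dI [c /andP[c0 c1] val]]]]]]] _].
have val' x : x != 0 -> exists i j, abs x * c ^+ i = c ^+ j.
  apply: completion_values dI _ x => a ia a0.
  by have [k _ ak] := val a ia a0; exists k.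
have exp x : 0 < abs x < 1 -> exists k : nat, abs x = c ^+ k.+1.
  move=> /andP[x0 x1]; have [|i [j ij]] := val' x.
    by rewrite -(absv_gt0 abs).
  have ci : 0 < c ^+ i by rewrite exprn_gt0.
  have ij' : (i < j)%N.
    by rewrite ltnNge; apply/negP => ji;
      move: (ler_wiXn2l (ltW c0) (ltW c1) ji); rewrite -ij leNgt gtr_pMl// x1.
  exists (j - i.+1)%N; apply: (mulIf (lt0r_neq0 ci)).
  by rewrite ij -exprD; congr (c ^+ _); lia.
have [a Pa a0] := pdiv_neq0 hP.
have [k [_ ak] aE] := val a (pdiv_sub hP Pa) a0.
(* For k = 0 the element [a] would lie outside the first power of P, although a = a * 1. *)
have k0 : k != 0%N.
  apply/eqP => k0; apply: ak; rewrite k0 /=; exists [:: (a, 1)].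
    move=> u; rewrite inE => /eqP -> /=; split => //.
    exact: integral1.
  by rewrite big_seq1 mulr1.
pose Q k := `[< exists x, abs x = c ^+ k.+1 >].
have exQ : exists k, Q k.
  by exists k.-1; apply/asboolP; exists (iota a); rewrite prednK ?lt0n.
case: (ex_minnP exQ) => k1 /asboolP[pi piE] min.
exists pi; first by rewrite piE exprn_gt0//= exprn_ilt1// ltW.
move=> x x1; have [->|x0] := eqVneq x 0; first by rewrite absv0 absv_ge0.
have [|k2 xE] := exp x; first by rewrite absv_gt0 x0 x1.
rewrite xE piE ler_wiXn2l ?ltW// ltnS; apply: min.
by apply/asboolP; exists x.
Qed.

(** For e = |pi|^N these are representatives of O / pi^N, congruence being expressed by distance. *)
Definition residue_system (T : finType) (rep : T -> K) (e : R) :=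
  (forall t, abs (rep t) <= 1) /\
  forall x, abs x <= 1 -> exists! t, abs (x - rep t) <= e.

(** A class modulo pi^(N+1) amounts to a first digit, lifted from the residue field, and a class
    modulo pi^N for the remainder divided by pi. *)
Lemma padic_residue_system p (pi : K) : padic_field abs p ->
  0 < abs pi < 1 -> (forall x, abs x < 1 -> abs x <= abs pi) ->
  forall N, exists (T : finType) (rep : T -> K),
    residue_system rep (abs pi ^+ N).
Proof.
move=> [_ _ [f _ [F [red [_ _ redDM redS red0]]]]] /andP[pi0 pi1] piM.
have /choice[lift liftP] : forall z, exists x, abs x <= 1 /\ red x = z.
  by move=> z; have [x] := redS z; exists x.
have redB x y : abs x <= 1 -> abs y <= 1 -> red (x - y) = red x - red y.
  move=> x1 y1; apply/(addIr (red y)); rewrite subrK.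
  rewrite -(redDM _ _ _ y1).1 ?subrK//.
  exact: absvB_le.
elim=> [|N [T [rep [rep1 repU]]]].
  exists unit, (fun=> 0); split=> [t|x x1]; first by rewrite absv0.
  by exists tt; split=> [|[]//]; rewrite subr0 expr0.
exists (F * T)%type, (fun u => lift u.1 + pi * rep u.2).
split=> [[z t]|x x1] /=.
  apply: absvD_le; first by case: (liftP z).
  by rewrite absvM mulr_ile1 ?absv_ge0 ?(ltW pi1).
have lx1 : abs (x - lift (red x)) <= abs pi.
  have [l1 lE] := liftP (red x).
  by apply: piM; apply/red0; [exact: absvB_le|rewrite redB// lE subrr].
have pin0 : pi != 0 by rewrite -(absv_gt0 abs).
have [|t [tP tU]] := repU ((x - lift (red x)) / pi).
  by rewrite absvM absvV ler_pdivrMr// mul1r.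
have scale y t' : abs (y - (pi * rep t')) <= abs pi ^+ N.+1 <->
    abs (y / pi - rep t') <= abs pi ^+ N.
  have -> : y - pi * rep t' = pi * (y / pi - rep t').
    by rewrite mulrBr mulrCA mulfV// mulr1.
  by rewrite absvM exprS ler_pM2l.
exists (red x, t); split=> [|[z t'] /= zt'].
  by rewrite /= opprD addrA; apply/scale.
(* [x - lift z] has absolute value at most |pi| < 1, so its reduction vanishes and the first digit
   is forced. *)
have zE : z = red x.
  have [l1 lE] := liftP z.
  rewrite -lE; apply/esym/subr0_eq; rewrite -redB//; apply/red0.
    exact: absvB_le.
  apply: (le_lt_trans _ pi1).
  have -> : x - lift z = (x - (lift z + pi * rep t')) + pi * rep t' by ring.
  apply: absvD_le.
    by rewrite (le_trans zt')// exprS ler_piMr ?exprn_ile1 ?ltW.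
  by rewrite absvM ler_piMr ?(ltW pi0).
rewrite zE in zt' *; congr pair; apply: tU; apply/scale.
by rewrite -addrA -opprD.
Qed.

End Completion.

(** * Averages over residue classes *)

Section Averaging.
Variables (R : realType) (K : fieldType) (abs : ultrametric_abs R K).
Variables (T : finType) (rep : T -> K) (e r : R).
Hypotheses (e0 : 0 <= e) (e1 : e < 1) (r0 : 0 < r).
Hypothesis repP : residue_system abs rep e.

Let A := \sum_t abs (rep t) `^ r.

(** The representative of the class of 1 has absolute value 1, because e < 1. *)
Lemma residue_sum_ge1 : 1 <= A.
Proof.
have [t [t1 _]] := repP.2 1 ltac:(by rewrite absv1).
rewrite /A (bigD1 t)//= (_ : abs (rep t) = 1) ?powR1 ?lerDl ?sumr_ge0//.
  by move=> i _; exact: powR_ge0.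
rewrite -(absv1 abs) -[rep t](subrK 1) absvDr// absv1 -absvN opprB.
exact: le_lt_trans e1.
Qed.

(* Translation by b permutes the residue classes, and only the class sent to 0
   fails to have a constant absolute value. *)
Lemma residue_sum_shift (b : K) : abs b <= 1 ->
  `|\sum_t abs (rep t + b) `^ r - A| <= e `^ r.
Proof.
move=> b1; have [rep1 repU] := repP.
(* [sg t] is the class of [rep t + b]; once injective on a finite type, [sg] is a permutation. *)
have /choice[sg sgP] : forall t, exists s, abs (rep t + b - rep s) <= e.
  move=> t; have [|s [sP _]] := repU (rep t + b); last by exists s.
  exact: absvD_le.
have sgI : injective sg.
  move=> t t' tt'; have [s [_ sU]] := repU _ (rep1 t).
  rewrite -(sU t) ?subrr ?absv0//; apply: sU.
  have -> : rep t - rep t' =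
      (rep t + b - rep (sg t)) - (rep t' + b - rep (sg t')).
    by rewrite tt'; ring.
  exact: absvB_le.
have [s0 [s0P s0U]] := repU 0 ltac:(by rewrite absv0).
rewrite /A [X in _ - X](reindex_inj sgI)/= -sumrB.
(* Only the index sent to the class [s0] of 0 survives; there both terms lie between 0 and e^r. *)
rewrite (bigD1 (invF sgI s0))//= big1 ?addr0.
  have h : abs (rep (sg (invF sgI s0))) <= e by rewrite f_invF -absvN -sub0r.
  have h' : abs (rep (invF sgI s0) + b) <= e.
    by rewrite -(subrK (rep (sg (invF sgI s0))) (_ + b)); exact: absvD_le.
  have mono x : abs x <= e -> abs x `^ r <= e `^ r.
    by move=> xe; rewrite ge0_ler_powR ?nnegrE ?absv_ge0// ltW.
  have := mono _ h; have := mono _ h'.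
  have q1 := powR_ge0 (abs (rep (sg (invF sgI s0)))) r.
  have q2 := powR_ge0 (abs (rep (invF sgI s0) + b)) r.
  by rewrite ler_norml => p1 p2; apply/andP; split; lra.
move=> t ts; rewrite -[rep t + b](subrK (rep (sg t))) absvDr ?subrr//.
apply: le_lt_trans (sgP t) _; rewrite ltNge; apply: contra ts => h.
by rewrite (s0U (sg t)) ?invF_f// sub0r absvN.
Qed.

(** Exchanging [t] with the value of [u] at [i] is an involution of the pairs (u, t), and it turns
    the updated function into [u]. *)
Lemma sum_ffun_update (I : finType) (i : I) (phi : {ffun I -> T} -> R) :
  \sum_(u : {ffun I -> T}) \sum_t phi [ffun j => if j == i then t else u j] =
  #|T|%:R * \sum_u phi u.
Proof.
rewrite pair_big/=.
pose h (v : {ffun I -> T} * T) :=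
  ([ffun j => if j == i then v.2 else v.1 j], v.1 i).
have hK : involutive h.
  move=> [u t]; rewrite /h /= ffunE eqxx; congr pair.
  by apply/ffunP => j; rewrite !ffunE; case: eqP => // ->.
rewrite (reindex_inj (inv_inj hK))/=.
under eq_bigr => v _.
  rewrite (_ : [ffun _ => _] = v.1).
    over.
  by have := congr1 fst (hK v).
rewrite -(pair_big xpredT xpredT (fun u _ => phi u))/=.
rewrite mulr_sumr; apply: eq_bigr => u _.
by rewrite sumr_const mulr_natl.
Qed.

(** Sum first over the coordinate [i] where |w_i| = M, the others being fixed: dividing by w_i
    leaves a sum shifted by some b in O. The index depends on [w] but the bound only on M, so that
    [w] may later vary with the point of integration. *)
Lemma residue_average (I : finType) (w : I -> K) (M : R) :
  (forall i, abs (w i) <= M) -> (exists2 i, abs (w i) = M & w i != 0) ->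
  `|#|T|%:R * (\sum_(u : {ffun I -> T}) abs (\sum_i rep (u i) * w i) `^ r)
    - #|{ffun I -> T}|%:R * (A * M `^ r)|
    <= #|{ffun I -> T}|%:R * (e `^ r * M `^ r).
Proof.
move=> wM [i wi wi0].
have M0 : 0 < M by rewrite -wi absv_gt0.
pose phi (u : {ffun I -> T}) := abs (\sum_i rep (u i) * w i) `^ r.
rewrite -(sum_ffun_update i phi).
have step (u : {ffun I -> T}) :
    `|\sum_t phi [ffun j => if j == i then t else u j] - A * M `^ r|
      <= e `^ r * M `^ r.
  pose b := (\sum_(j | j != i) rep (u j) * w j) / w i.
  have b1 : abs b <= 1.
    rewrite absvM absvV ler_pdivrMr ?absv_gt0// mul1r wi.
    apply: absv_sum_le => [|j _]; first exact: ltW.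
    by rewrite absvM -[M]mul1r ler_pM ?absv_ge0//; case: repP.
  have -> : \sum_t phi [ffun j => if j == i then t else u j] =
      (\sum_t abs (rep t + b) `^ r) * M `^ r.
    rewrite mulr_suml; apply: eq_bigr => t _.
    rewrite /phi -powRM ?absv_ge0 ?(ltW M0)// -wi -absvM mulrDl divfK//.
    rewrite (bigD1 i)//= ffunE eqxx; congr (abs (_ + _) `^ _).
    by apply: eq_bigr => j /negPf ji; rewrite ffunE ji.
  rewrite -mulrBl normrM (ger0_norm (powR_ge0 M r)).
  by rewrite ler_wpM2r ?powR_ge0//; exact: residue_sum_shift.
have -> : #|{ffun I -> T}|%:R * (A * M `^ r) =
    \sum_(u : {ffun I -> T}) (A * M `^ r).
  by rewrite sumr_const mulr_natl.
rewrite -sumrB (le_trans (ler_norm_sum _ _ _))//.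
by rewrite mulr_natl -sumr_const; exact: ler_sum.
Qed.

End Averaging.

(** * Borel sets of K^n *)

Section BorelSpace.
Variables (R : realType) (K : fieldType) (abs : ultrametric_abs R K) (n : nat).
Local Notation V := 'rV[valued_field abs]_n.

(** The conjunct 0 < e matters for n = 0, where there is no coordinate to compare. *)
Lemma ball_rowE (x y : V) (e : R) :
  ball x e y <-> 0 < e /\ forall i, abs (x ord0 i - y ord0 i) < e.
Proof.
split=> [[e0 xy]|[e0 xy]]; split=> // i; last move=> j.
  by have := xy ord0 i; rewrite ballEmdist.
by rewrite ord1 ballEmdist; exact: xy.
Qed.

(** The function is Lipschitz with constant [S] for the maximum distance, hence preimages of open
    intervals are open. The summand 1 keeps [S] positive when v = 0. *)
Lemma measurable_abs_affine (t : K) (v : 'rV[K]_n) :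
  measurable_fun setT
    (fun x : borel_space abs n => abs (t + \sum_i v ord0 i * x ord0 i)).
Proof.
pose h (x : V) := abs (t + \sum_i v ord0 i * x ord0 i).
pose S := 1 + \sum_i abs (v ord0 i).
have S0 : 0 < S by rewrite ltr_pwDl// sumr_ge0// => i _; exact: absv_ge0.
have ltD x y : abs x <= abs (x - y) + abs y.
  rewrite -{1}(subrK y x) (le_trans (absvD _ _ _))//.
  by rewrite ge_max lerDl lerDr !absv_ge0.
have lip (x y : V) (e : R) : ball x (e / S) y -> `|h x - h y| < e.
  move=> /ball_rowE[eS xy].
  have e0 : 0 < e by rewrite -(divfK (lt0r_neq0 S0) e) mulr_gt0.
  have hh : abs ((t + \sum_i v ord0 i * x ord0 i) -
      (t + \sum_i v ord0 i * y ord0 i)) < e.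
    rewrite opprD addrACA subrr add0r -sumrB.
    have le1 : e / S * (S - 1) < e.
      by rewrite mulrBr divfK ?gt_eqF// mulr1 ltrBlDr ltrDl.
    apply: le_lt_trans le1; apply: absv_sum_le => [|i _].
      by rewrite mulr_ge0 ?(ltW eS)// /S addrC addKr sumr_ge0// => i _;
        exact: absv_ge0.
    rewrite -mulrBr absvM mulrC ler_pM ?absv_ge0 ?(ltW (xy i))//.
    rewrite /S addrC addKr (bigD1 i)//= lerDl sumr_ge0// => j _.
    exact: absv_ge0.
  have h1 : h x <= _ := ltD _ (t + \sum_i v ord0 i * y ord0 i).
  have h2 : h y <= _ := ltD _ (t + \sum_i v ord0 i * x ord0 i).
  rewrite -(absvN abs (_ - (t + \sum_i v ord0 i * x ord0 i))) opprB in h2.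
  by rewrite ltr_norml; apply/andP; split; rewrite /h in h1 h2 *; lra.
apply: (measurability _ (RGenOpens.measurableE R)).
move=> _ [_ [a [b ->] <-]]; rewrite setTI; apply: sub_sigma_algebra.
rewrite openE => x /=; rewrite in_itv/= => /andP[ax xb].
pose e := Num.min (h x - a) (b - h x).
have e0 : 0 < e by rewrite lt_min !subr_gt0 ax xb.
apply/nbhs_ballP; exists (e / S); first exact: divr_gt0.
move=> y /lip; rewrite lt_min => /andP[]; rewrite !ltr_norml /= in_itv/=.
by move=> /andP[h1 h2] /andP[h3 h4]; apply/andP; split; rewrite -/(h y); lra.
Qed.

Definition polydisc (c : V) (e : R) : set V :=
  [set x | forall i, abs (x ord0 i - c ord0 i) <= e].

Lemma polydisc_eq (c x : V) (e : R) :
  polydisc c e x -> polydisc c e = polydisc x e.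
Proof.
move=> cx; apply/seteqP; split=> y cy i /=.
  have -> : y ord0 i - x ord0 i = (y ord0 i - c ord0 i) - (x ord0 i - c ord0 i).
    by ring.
  exact: absvB_le.
have -> : y ord0 i - c ord0 i = (y ord0 i - x ord0 i) + (x ord0 i - c ord0 i).
  by ring.
exact: absvD_le.
Qed.

Lemma le_polydisc (c : V) (e1 e2 : R) : e1 <= e2 ->
  polydisc c e1 `<=` polydisc c e2.
Proof. by move=> e12 x cx i; exact: le_trans (cx i) e12. Qed.

Lemma polydisc_nested (c1 c2 : V) (e1 e2 : R) : e1 <= e2 ->
  polydisc c1 e1 `&` polydisc c2 e2 = set0 \/
  polydisc c1 e1 `&` polydisc c2 e2 = polydisc c1 e1.
Proof.
move=> e12.
have [->|/set0P[x [x1 x2]]] :=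
  eqVneq (polydisc c1 e1 `&` polydisc c2 e2) set0; first by left.
right; rewrite (polydisc_eq x1) (polydisc_eq x2); apply/setIidl.
exact: le_polydisc.
Qed.

Lemma open_polydisc (c : V) (e : R) : 0 < e -> open (polydisc c e).
Proof.
move=> e0; rewrite openE => x cx; apply/nbhs_ballP; exists e => //.
move=> y /ball_rowE[_ xy]; rewrite (polydisc_eq cx) => i.
by rewrite -absvN opprB ltW.
Qed.

(** Each point of an open set lies in a polydisc contained in it, with radius some [a k] and center
    coordinates in the dense sequence [D]; only countably many polydiscs are of this kind. *)
Lemma borel_polydisc (a : nat -> R) (D : nat -> K) :
  (forall k, 0 < a k) -> (forall e, 0 < e -> exists k, a k < e) ->
  (forall x e, 0 < e -> exists m, abs (x - D m) < e) ->
  forall G : set (set V), (forall c k, G (polydisc c (a k))) ->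
  @measurable _ (borel_space abs n) `<=` <<s G >>.
Proof.
move=> a0 alim dD G Gdisc; apply: smallest_sub.
  exact: smallest_sigma_algebra.
move=> U oU.
pose c (m : {ffun 'I_n -> nat}) : V := \row_i D (m i).
pose B (mk : {ffun 'I_n -> nat} * nat) : set V :=
  if `[< polydisc (c mk.1) (a mk.2) `<=` U >] then polydisc (c mk.1) (a mk.2)
  else set0.
have -> : U = \bigcup_mk B mk.
  apply/seteqP; split=> [x Ux|x [mk _]]; last first.
    by rewrite /B; case: asboolP => // sub; exact: sub.
  have [e /= e0 xe] : nbhs_ball x U.
    by apply/nbhs_ballP; move: oU; rewrite openE; apply.
  have [k ke] := alim e e0.
  have /choice[m mP] : forall i, exists m, abs (x ord0 i - D m) < a k.
    by move=> i; exact: dD.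
  have xB : polydisc (c [ffun i => m i]) (a k) x.
    by move=> i; rewrite mxE ffunE ltW.
  exists ([ffun i => m i], k) => //; rewrite /B/=; case: asboolP => // -[].
  rewrite (polydisc_eq xB) => y xy; apply/xe/ball_rowE; split=> // i.
  by rewrite -absvN opprB (le_lt_trans (xy i)).
apply: (@countable_bigcupT_measurable _ (g_sigma_algebraType G)).
  exact: countableP.
move=> mk; rewrite /B; case: asboolP => _; last exact: measurable0.
by apply: sub_sigma_algebra; exact: Gdisc.
Qed.

End BorelSpace.

(** The number field is dense in K, and countable through rational coordinates in a basis. *)
Lemma padic_separable (R : realType) (K : fieldType)
    (abs : ultrametric_abs R K) p : padic_field abs p ->
  exists D : nat -> K, forall x e, 0 < e -> exists m, abs (x - D m) < e.
Proof.
move=> [_ [L [P [_ [_ [iota [dI _]]]]]] _].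
pose lc (v : {ffun 'I_(\dim {:L}) -> rat}) :=
  \sum_i v i *: (vbasis {:L})`_i.
exists (fun m => if unpickle m is Some v then iota (lc v) else 0) => x e e0.
have [_ [a _ <-] xa] := dense_approx x dI e0.
exists (pickle [ffun i => coord (vbasis {:L}) i a]); rewrite pickleK.
rewrite (_ : lc _ = a)// [RHS](coord_vbasis (memvf a)).
by apply: eq_bigr => i _; rewrite ffunE.
Qed.

(** * Moments *)

Lemma exprn_small (R : realType) (q e : R) : 0 <= q < 1 -> 0 < e ->
  exists N, q ^+ N < e.
Proof.
move=> /andP[q0 q1] e0.
have /cvgrPdist_lt/(_ e e0)[N _ NP] : (q ^+ k @[k --> \oo] --> (0 : R)).
  by apply: cvg_expr; rewrite ger0_norm.
by exists N; have := NP N (leqnn N);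
  rewrite /= sub0r normrN ger0_norm ?exprn_ge0.
Qed.

Lemma powR_exprn (R : realType) (a s : R) N : 0 <= a ->
  (a ^+ N) `^ s = (a `^ s) ^+ N.
Proof.
move=> a0; elim: N => [|N IH]; first by rewrite !expr0 powR1.
by rewrite !exprS powRM ?exprn_ge0// IH.
Qed.

(** Exponents above 1 are allowed because, by the ultrametric inequality, one of the two terms alone
    dominates. *)
Lemma powR_absvD (R : realType) (K : fieldType)
    (abs : ultrametric_abs R K) (s : R) (x y : K) :
  0 < s -> abs (x + y) `^ s <= abs x `^ s + abs y `^ s.
Proof.
move=> s0.
have mono z : abs (x + y) <= abs z -> abs (x + y) `^ s <= abs z `^ s.
  by move=> xz; rewrite ge0_ler_powR ?nnegrE ?absv_ge0// ltW.
have := absvD abs x y; rewrite le_max => /orP[] /mono h; apply: (le_trans h).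
  by rewrite lerDl powR_ge0.
by rewrite lerDr powR_ge0.
Qed.

Section MaxDist.
Variables (R : realType) (K : fieldType) (abs : ultrametric_abs R K) (n : nat).

(** With e = |a| this is the maximum norm of the vector (a, y - c) of K^(n+1), which [cons_row]
    builds. *)
Definition max_dist (e : R) (c y : 'rV[K]_n) : R :=
  \big[Num.max/e]_i abs (y ord0 i - c ord0 i).

Definition cons_row (a : K) (y : 'rV[K]_n) (j : 'I_n.+1) : K :=
  if unlift ord0 j is Some i then y ord0 i else a.

Lemma max_dist_attained (a : K) (c y : 'rV[K]_n) :
  exists j, abs (cons_row a (y - c) j) = max_dist (abs a) c y.
Proof.
rewrite /max_dist.
apply: (big_ind (fun m => exists j, abs (cons_row a (y - c) j) = m)).
- by exists ord0; rewrite /cons_row unlift_none.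
- move=> ? ? [i <-] [j <-].
  by rewrite maxElt; case: ifP => _; [exists j|exists i].
- by move=> i _; exists (lift ord0 i); rewrite /cons_row liftK !mxE.
Qed.

Lemma max_dist_ge (a : K) (c y : 'rV[K]_n) j :
  abs (cons_row a (y - c) j) <= max_dist (abs a) c y.
Proof.
rewrite /cons_row /max_dist; case: unliftP => [i _|_].
  by rewrite !mxE; exact: le_bigmax.
exact: bigmax_ge_id.
Qed.

(** This puts the linear forms that are averaged into the shape required by [affine_moment]. *)
Lemma affine_cons_row (a : K) (c y : 'rV[K]_n) (z : 'I_n.+1 -> K) :
  \sum_j z j * cons_row a (y - c) j =
  (z ord0 * a - \sum_i z (lift ord0 i) * c ord0 i) +
    \sum_i (\row_i z (lift ord0 i)) ord0 i * y ord0 i.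
Proof.
rewrite big_ord_recl /cons_row unlift_none -addrA; congr (_ + _).
rewrite addrC -sumrB; apply: eq_bigr => i _.
by rewrite liftK !mxE mulrBr.
Qed.

End MaxDist.

Section Moments.
Variables (R : realType) (K : fieldType) (abs : ultrametric_abs R K) (n : nat).
Variables (d : measure_display) (X : measurableType d).
Variables (mu : {measure set X -> \bar R}) (F : X -> 'rV[K]_n) (s : R).

Definition affine_moment (t : K) (v : 'rV[K]_n) : \bar R :=
  (\int[mu]_x (abs (t + \sum_i v ord0 i * F x ord0 i) `^ s)%:E)%E.

Definition max_moment (e : R) (c : 'rV[K]_n) : \bar R :=
  (\int[mu]_x (max_dist abs e c (F x) `^ s)%:E)%E.

Hypothesis mF : measurable_fun setT (F : X -> borel_space abs n).

Lemma measurable_affine_powR (t : K) (v : 'rV[K]_n) :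
  measurable_fun setT (fun x => abs (t + \sum_i v ord0 i * F x ord0 i) `^ s).
Proof.
apply: (measurableT_comp (measurable_powR s)).
exact: (measurableT_comp (@measurable_abs_affine _ _ abs _ t v) mF).
Qed.

Lemma measurable_max_dist (e : R) (c : 'rV[K]_n) :
  measurable_fun setT (fun x => max_dist abs e c (F x)).
Proof.
rewrite /max_dist; elim: (index_enum _) => [|i l IH].
  by under eq_fun do rewrite big_nil; exact: measurable_cst.
under eq_fun do rewrite big_cons; apply: measurable_maxr => //.
have := measurableT_comp
  (@measurable_abs_affine _ _ abs _ (- c ord0 i) (delta_mx ord0 i)) mF.
apply: eq_measurable_fun => x _ /=; rewrite addrC (bigD1 i)//= mxE !eqxx mul1r.
rewrite big1 ?addr0// => j ji.
by rewrite mxE (negPf ji) andbF mul0r.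
Qed.

Lemma measurable_max_powR (e : R) (c : 'rV[K]_n) :
  measurable_fun setT (fun x => max_dist abs e c (F x) `^ s).
Proof.
exact: (measurableT_comp (measurable_powR s) (measurable_max_dist e c)).
Qed.

Lemma max_moment_ge0 e c : (0 <= max_moment e c)%E.
Proof. by apply: integral_ge0 => x _; rewrite lee_fin powR_ge0. Qed.

(** Homogeneity reduces the moments with nonzero constant term to those with constant term 1. *)
Lemma affine_momentZ (a t : K) (v : 'rV[K]_n) :
  affine_moment (a * t) (a *: v) = ((abs a `^ s)%:E * affine_moment t v)%E.
Proof.
rewrite /affine_moment -ge0_integralZl_EFin//; last 3 first.
- by move=> x _; rewrite lee_fin powR_ge0.
- exact/measurable_EFinP/measurable_affine_powR.
- exact: powR_ge0.
apply: eq_integral => x _; rewrite -EFinM -powRM ?absv_ge0// -absvM.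
congr ((abs _) `^ _)%:E; rewrite mulrDr mulr_sumr; congr (_ + _).
by apply: eq_bigr => i _; rewrite mxE mulrA.
Qed.

Lemma ge0_integral_lincomb (I : finType) (a : R) (f : I -> X -> R) :
  0 <= a -> (forall i x, 0 <= f i x) ->
  (forall i, measurable_fun setT (f i)) ->
  (\int[mu]_x (a * \sum_i f i x)%:E =
   a%:E * \sum_i \int[mu]_x (f i x)%:E)%E.
Proof.
move=> a0 f0 mf; rewrite -ge0_integral_sum//; last 2 first.
- by move=> i; exact/measurable_EFinP.
- by move=> i x _; rewrite lee_fin.
rewrite -ge0_integralZl_EFin//; last 2 first.
- by move=> x _; rewrite sume_ge0// => i _; rewrite lee_fin.
- by apply: emeasurable_sum => i; exact/measurable_EFinP.
by apply: eq_integral => x _; rewrite EFinM sumEFin.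
Qed.

(** The total mass is thus one of the integrals given in the theorem. *)
Lemma affine_moment10 : affine_moment 1 0 = mu setT.
Proof.
rewrite /affine_moment (eq_integral (cst 1%E)) ?integral_cst ?mul1e//.
move=> x _; rewrite big1 ?addr0 ?absv1 ?powR1// => i _.
by rewrite mxE mul0r.
Qed.

(** Moments with constant term 0 are out of reach of scaling; this bound reaches them by perturbing
    the constant term. *)
Lemma affine_momentD_le (t t' : K) (v : 'rV[K]_n) :
  0 < s ->
  (affine_moment (t + t') v <=
   affine_moment t v + (abs t' `^ s)%:E * mu setT)%E.
Proof.
move=> s0.
rewrite /affine_moment -integral_cst// -ge0_integralD//; last 3 first.
- by move=> x _; rewrite lee_fin powR_ge0.
- exact/measurable_EFinP/measurable_affine_powR.
- by move=> x _; rewrite lee_fin powR_ge0.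
apply: ge0_le_integral => //.
- by move=> x _; rewrite lee_fin powR_ge0.
- exact/measurable_EFinP/measurable_affine_powR.
- apply: emeasurable_funD; last exact: measurable_cst.
  exact/measurable_EFinP/measurable_affine_powR.
- by move=> x _; rewrite /cst -EFinD lee_fin addrAC; exact: powR_absvD.
Qed.

(** The power of a maximum is at most the sum of the powers of the entries, and each entry of (a, y
    - c) is affine in y. *)
Lemma max_moment_fin (a : K) (c : 'rV[K]_n) :
  (forall t v, affine_moment t v < +oo)%E ->
  (max_moment (abs a) c < +oo)%E.
Proof.
(* [tt j] and [vv j] are the constant and linear parts of entry [j]: [a] for j = 0, then the
   differences y_i - c_i. *)
move=> affoo; pose tt j : K := (if j == ord0 then a else 0) -
  (if unlift ord0 j is Some i then c ord0 i else 0).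
pose vv j : 'rV[K]_n :=
  if unlift ord0 j is Some i then delta_mx ord0 i else 0.
have cE j y : cons_row a (y - c) j = tt j + \sum_i vv j ord0 i * y ord0 i.
  rewrite /cons_row /tt /vv; case: unliftP => [i ->|->].
    rewrite sub0r (bigD1 i)//= !mxE !eqxx mul1r big1 ?addr0 1?addrC//.
    by move=> k ki; rewrite mxE (negPf ki) andbF mul0r.
  by rewrite subr0 big1 ?addr0// => i _; rewrite mxE mul0r.
apply: (@le_lt_trans _ _ (\sum_j affine_moment (tt j) (vv j))%E).
  rewrite -[leRHS]mul1e -ge0_integral_lincomb//; last 2 first.
  - by move=> j x; exact: powR_ge0.
  - by move=> j; exact: measurable_affine_powR.
  apply: ge0_le_integral => //.
  - by move=> x _; rewrite lee_fin powR_ge0.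
  - exact/measurable_EFinP/measurable_max_powR.
  - apply/measurable_EFinP/measurable_funM; first exact: measurable_cst.
    by apply: measurable_sum => j; exact: measurable_affine_powR.
  - move=> x _; rewrite mul1r lee_fin.
    have [j <-] := max_dist_attained abs a c (F x).
    rewrite (bigD1 j)//= -cE lerDl sumr_ge0// => i _; exact: powR_ge0.
by apply: lte_sum_pinfty => j _; exact: affoo.
Qed.

End Moments.

(** * Comparison of the two measures *)

Section Comparison.
Variables (R : realType) (K : fieldType) (abs : ultrametric_abs R K) (n : nat).
Variables (pi : K) (s : R).
Hypotheses (pi01 : 0 < abs pi < 1) (s0 : 0 < s).
Variables (dX dY : measure_display).
Variables (X : measurableType dX) (Y : measurableType dY).
Variables (mu : {measure set X -> \bar R}) (nu : {measure set Y -> \bar R}).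
Variables (F : X -> 'rV[K]_n) (G : Y -> 'rV[K]_n).
Hypotheses (mF : measurable_fun setT (F : X -> borel_space abs n))
  (mG : measurable_fun setT (G : Y -> borel_space abs n)).

Lemma pow_pi_small (e : R) : 0 < e -> exists N, (abs pi ^+ N) `^ s < e.
Proof.
move: pi01 => /andP[pi0 pi1] e0.
have [N Ne] : exists N, (abs pi `^ s) ^+ N < e.
  apply: exprn_small => //; rewrite powR_ge0/=.
  suff : abs pi `^ s < 1 `^ s by rewrite powR1.
  by rewrite gt0_ltr_powR// nnegrE ltW.
by exists N; rewrite powR_exprn// ltW.
Qed.

(* The moments with t = 0 are limits of those with t = pi ^+ N. *)
Lemma affine_moment0_le (v : 'rV[K]_n) :
  (mu setT < +oo)%E -> (nu setT < +oo)%E ->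
  (forall t, t != 0 ->
     affine_moment abs mu F s t v = affine_moment abs nu G s t v) ->
  (affine_moment abs mu F s 0 v <= affine_moment abs nu G s 0 v)%E.
Proof.
move=> muoo nuoo eq; apply/lee_addgt0Pr => e e0.
have mufin : mu setT \is a fin_num by rewrite ge0_fin_numE.
have nufin : nu setT \is a fin_num by rewrite ge0_fin_numE.
(* Passing from 0 to t costs |t|^s times the mass of [mu] on one side, and from t back to 0 the same
   with [nu] on the other. [M] exceeds the sum of the masses and is positive. *)
pose M := fine (mu setT) + fine (nu setT) + 1.
have M0 : 0 < M by rewrite ltr_wpDl// addr_ge0// fine_ge0.
have [N Ne] := pow_pi_small (divr_gt0 e0 M0).
pose t := pi ^+ N.
have t0 : t != 0.
  by rewrite expf_neq0// -(absv_gt0 abs); case/andP: pi01.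
have h1 := affine_momentD_le mu mF t (- t) v s0.
have h2 := affine_momentD_le nu mG 0 t v s0.
rewrite subrr absvN in h1; rewrite add0r in h2.
apply: (le_trans h1); rewrite eq//.
apply: (le_trans (leeD2r _ h2)); rewrite -addeA; apply: leeD2l.
rewrite -(fineK mufin) -(fineK nufin) -!EFinM -EFinD lee_fin -mulrDr.
have := ltW Ne; rewrite ler_pdivlMr// -absvX => h.
apply: le_trans h; rewrite ler_wpM2l ?powR_ge0// /M; lra.
Qed.

Hypothesis repP : forall N, exists (T : finType) (rep : T -> K),
  residue_system abs rep (abs pi ^+ N).
Hypothesis affoo : forall t v, (affine_moment abs mu F s t v < +oo)%E.

(** The averaged moments agree on both sides and determine the max moments up to a relative error
    that vanishes as N grows. One inequality suffices, since the roles of the measures can be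
    exchanged. *)
Lemma max_moment_le (a : K) (c : 'rV[K]_n) : a != 0 ->
  (max_moment abs nu G s (abs a) c < +oo)%E ->
  (forall t v, affine_moment abs mu F s t v = affine_moment abs nu G s t v) ->
  (max_moment abs mu F s (abs a) c <= max_moment abs nu G s (abs a) c)%E.
Proof.
move=> a0 Goo eq; have Foo := max_moment_fin mF a c affoo.
have Ffin : max_moment abs mu F s (abs a) c \is a fin_num.
  by rewrite ge0_fin_numE ?max_moment_ge0.
have Gfin : max_moment abs nu G s (abs a) c \is a fin_num.
  by rewrite ge0_fin_numE ?max_moment_ge0.
have [pi0 pi1] := andP pi01.
rewrite -(fineK Ffin) -(fineK Gfin) lee_fin leNgt; apply/negP => ji.
set i := fine _ in ji; set j := fine _ in ji.
have i0 : 0 <= i by rewrite fine_ge0// max_moment_ge0.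
(* Here [i] belongs to [nu] and [j] to [mu]. Averaging will give (A - e^s) j <= (A + e^s) i, hence j
   - i <= e^s (j + i) as A >= 1; N is chosen to contradict this. *)
have ij0 : 0 < (j - i) / (j + i + 1).
  by rewrite divr_gt0 ?subr_gt0//; lra.
have [N Ne] := pow_pi_small ij0.
(* The exponent N + 1 ensures e < 1 even when N = 0, as [residue_sum_ge1] requires. *)
have {}Ne : (abs pi ^+ N.+1) `^ s < (j - i) / (j + i + 1).
  apply: le_lt_trans Ne.
  rewrite ge0_ler_powR ?nnegrE ?exprn_ge0 ?(ltW s0) ?(ltW pi0)//.
  by rewrite exprS ler_piMl ?exprn_ge0 ?(ltW pi0) ?(ltW pi1).
have [T [rep rP]] := repP N.+1.
set e := abs pi ^+ N.+1 in rP Ne.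
have e1 : e < 1 by rewrite exprn_ilt1// ltW.
have e0 : 0 <= e by rewrite exprn_ge0// ltW.
pose A := \sum_t abs (rep t) `^ s.
have A1 : 1 <= A := residue_sum_ge1 s e1 rP.
pose U := {ffun 'I_n.+1 -> T}.
pose tu (u : U) := rep (u ord0) * a - \sum_i rep (u (lift ord0 i)) * c ord0 i.
pose vu (u : U) : 'rV[K]_n := \row_i rep (u (lift ord0 i)).
have avg (y : 'rV[K]_n) :
  `|#|T|%:R * (\sum_u abs (tu u + \sum_i vu u ord0 i * y ord0 i) `^ s)
    - #|U|%:R * (A * max_dist abs (abs a) c y `^ s)|
    <= #|U|%:R * (e `^ s * max_dist abs (abs a) c y `^ s).
  have w0 : exists2 k, abs (cons_row a (y - c) k) = max_dist abs (abs a) c y &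
      cons_row a (y - c) k != 0.
    have [k kE] := max_dist_attained abs a c y; exists k => //.
    rewrite -(absv_gt0 abs) kE (lt_le_trans (y := abs a)) ?absv_gt0//.
    exact: bigmax_ge_id.
  have := residue_average e0 s0 rP (max_dist_ge abs a c y) w0.
  by under eq_bigr => u _ do rewrite affine_cons_row.
have es1 : e `^ s <= A.
  apply: le_trans A1; suff : e `^ s <= 1 `^ s by rewrite powR1.
  by rewrite ge0_ler_powR ?nnegrE// ltW.
have es0 := powR_ge0 e s.
have mAff (d : measure_display) (Z : measurableType d) (H : Z -> 'rV[K]_n)
    (mH : measurable_fun setT (H : Z -> borel_space abs n)) :
  measurable_fun setT (fun z => (#|T|%:R * \sum_u
    abs (tu u + \sum_i vu u ord0 i * H z ord0 i) `^ s)%:E).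
  apply/measurable_EFinP/measurable_funM; first exact: measurable_cst.
  by apply: measurable_sum => u; exact: measurable_affine_powR.
have mMax b (d : measure_display) (Z : measurableType d) (H : Z -> 'rV[K]_n)
    (mH : measurable_fun setT (H : Z -> borel_space abs n)) :
  measurable_fun setT
    (fun z => (b%:E * (max_dist abs (abs a) c (H z) `^ s)%:E)%E).
  apply: emeasurable_funM; first exact: measurable_cst.
  exact/measurable_EFinP/measurable_max_powR.
(* The lower half of [avg] is integrated against [mu], the upper half against [nu]. *)
have lo : (((#|U|%:R * (A - e `^ s))%:E * max_moment abs mu F s (abs a) c) <=
    #|T|%:R%:E * \sum_u affine_moment abs mu F s (tu u) (vu u))%E.
  rewrite -ge0_integral_lincomb//; last 2 first.
  - by move=> u x; exact: powR_ge0.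
  - by move=> u; exact: measurable_affine_powR.
  rewrite -ge0_integralZl_EFin//; last 3 first.
  - by move=> x _; rewrite lee_fin powR_ge0.
  - exact/measurable_EFinP/measurable_max_powR.
  - by rewrite mulr_ge0// subr_ge0.
  apply: ge0_le_integral => //; [|exact: mMax|exact: mAff|].
  - by move=> x _; rewrite lee_fin mulr_ge0 ?powR_ge0// mulr_ge0// subr_ge0.
  - move=> x _; rewrite -EFinM lee_fin.
    by have := avg (F x); rewrite ler_norml => /andP[h _]; lra.
have hi : ((#|T|%:R%:E * \sum_u affine_moment abs nu G s (tu u) (vu u)) <=
   (#|U|%:R * (A + e `^ s))%:E * max_moment abs nu G s (abs a) c)%E.
  rewrite -ge0_integral_lincomb//; last 2 first.
  - by move=> u x; exact: powR_ge0.
  - by move=> u; exact: measurable_affine_powR.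
  rewrite -ge0_integralZl_EFin//; last 3 first.
  - by move=> x _; rewrite lee_fin powR_ge0.
  - exact/measurable_EFinP/measurable_max_powR.
  - by rewrite mulr_ge0// addr_ge0// (le_trans _ A1).
  apply: ge0_le_integral => //; [|exact: mAff|exact: mMax|].
  - move=> x _; rewrite lee_fin mulr_ge0// sumr_ge0// => u _.
    exact: powR_ge0.
  - move=> x _; rewrite -EFinM lee_fin.
    by have := avg (G x); rewrite ler_norml => /andP[_ h]; lra.
have : ((#|U|%:R * (A - e `^ s))%:E * j%:E <=
    (#|U|%:R * (A + e `^ s))%:E * i%:E)%E.
  rewrite !fineK//; apply: (le_trans lo); apply: le_trans hi.
  by rewrite (eq_bigr (fun u => affine_moment abs nu G s (tu u) (vu u))).
(* The common factor #|U| cancels: [T] is inhabited by the class of 0. *)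
rewrite -!EFinM lee_fin -!mulrA ler_pM2l; last first.
  have [t _] := rP.2 0 ltac:(by rewrite absv0).
  by rewrite ltr0n; apply/card_gt0P; exists [ffun=> t].
move: Ne; rewrite ltr_pdivlMr; last by lra.
nra.
Qed.

End Comparison.

(** No absolute value lies strictly between |pi|^(k+1) and |pi|^k. Inside the polydisc each maximum
    is its own radius; outside, both equal the distance from [y] to [c]. *)
Lemma max_dist_polydisc (R : realType) (K : fieldType)
    (abs : ultrametric_abs R K) (n : nat) (pi : K) (s : R) (k : nat)
    (c y : 'rV[K]_n) :
  0 < abs pi < 1 -> (forall x, abs x < 1 -> abs x <= abs pi) ->
  max_dist abs (abs pi ^+ k) c y `^ s =
  max_dist abs (abs pi ^+ k.+1) c y `^ s +
  ((abs pi ^+ k) `^ s - (abs pi ^+ k.+1) `^ s) *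
    \1_(polydisc (abs := abs) c (abs pi ^+ k.+1)) y.
Proof.
move=> /andP[pi0 pi1] piM; rewrite indicE.
have kk : abs pi ^+ k.+1 <= abs pi ^+ k.
  by rewrite exprS ler_piMl ?exprn_ge0 ?(ltW pi0) ?(ltW pi1).
have [/set_mem/= yc|/negP yc] := boolP (y \in _).
  have mE e : abs pi ^+ k.+1 <= e -> max_dist abs e c y = e.
    move=> ke; apply/le_anti; rewrite bigmax_ge_id andbT.
    by apply: bigmax_le => // i _; exact: le_trans (yc i) ke.
  by rewrite !mE// mulr1 addrC subrK.
rewrite mulr0 addr0; congr (_ `^ _).
have [i yi] : exists i, abs pi ^+ k.+1 < abs (y ord0 i - c ord0 i).
  apply/not_existsP => h; apply/yc/mem_set => i.
  by rewrite leNgt; apply/negP/h.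
(* Divided by pi^k, a difference of absolute value below |pi|^k falls under the maximality of
   |pi|. *)
have {}yi : abs pi ^+ k <= abs (y ord0 i - c ord0 i).
  rewrite leNgt; apply/negP => h.
  have pik : 0 < abs pi ^+ k by rewrite exprn_gt0.
  have := piM ((y ord0 i - c ord0 i) / pi ^+ k).
  rewrite absvM absvV absvX ltr_pdivrMr// mul1r ler_pdivrMr// -exprS.
  by move=> /(_ h); rewrite leNgt yi.
apply/le_anti/andP; split; apply: bigmax_le => [|j _].
- by apply: le_trans yi _; exact: le_bigmax.
- exact: le_bigmax.
- exact: le_trans kk (bigmax_ge_id _ _ _ _).
- exact: le_bigmax.
Qed.

(** Written as a sum, the identity also makes sense for infinite moments. *)
Lemma max_moment_polydisc (R : realType) (K : fieldType)
    (abs : ultrametric_abs R K) (n : nat) (pi : K) (s : R)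
    (d : measure_display) (X : measurableType d)
    (mu : {measure set X -> \bar R}) (F : X -> 'rV[K]_n) (k : nat)
    (c : 'rV[K]_n) :
  0 < s -> 0 < abs pi < 1 -> (forall x, abs x < 1 -> abs x <= abs pi) ->
  measurable_fun setT (F : X -> borel_space abs n) ->
  (max_moment abs mu F s (abs pi ^+ k) c =
   max_moment abs mu F s (abs pi ^+ k.+1) c +
   ((abs pi ^+ k) `^ s - (abs pi ^+ k.+1) `^ s)%:E *
     mu (F @^-1` polydisc (abs := abs) c (abs pi ^+ k.+1)))%E.
Proof.
move=> s0 pi01 piM mF; have [pi0 pi1] := andP pi01.
set B := polydisc _ _; set b := (_ - _)%R.
have b0 : 0 <= b.
  rewrite subr_ge0 ge0_ler_powR ?nnegrE ?exprn_ge0 ?(ltW s0) ?(ltW pi0)//.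
  by rewrite exprS ler_piMl ?exprn_ge0 ?(ltW pi0) ?(ltW pi1).
have mB : measurable (F @^-1` B).
  rewrite -[X in measurable X]setTI; apply: mF => //.
  by apply: sub_sigma_algebra; apply: open_polydisc; exact: exprn_gt0.
have -> : mu (F @^-1` B) = (\int[mu]_x (\1_B (F x))%:E)%E.
  rewrite (eq_integral (EFin \o \1_(F @^-1` B))) ?integral_indic ?setIT//.
have mI : measurable_fun setT (fun x => \1_B (F x) : R).
  exact: (@measurable_indic _ _ _ setT (F @^-1` B)).
rewrite -ge0_integralZl_EFin//; last exact/measurable_EFinP.
rewrite /max_moment -ge0_integralD//; last 4 first.
- by move=> x _; rewrite lee_fin powR_ge0.
- exact/measurable_EFinP/measurable_max_powR.
- by move=> x _; rewrite -EFinM lee_fin mulr_ge0.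
- apply/measurable_EFinP/measurable_funM; first exact: measurable_cst.
  exact: mI.
apply: eq_integral => x _; rewrite -EFinM -EFinD.
by rewrite (max_dist_polydisc s k c (F x) pi01 piM).
Qed.

(** * Equality on polydiscs, then on all Borel sets *)

Theorem theorem5p2 (R : realType) (p : nat)
    (K : fieldType) (abs : ultrametric_abs R K) (hK : padic_field abs p)
    (n : nat) (r : rat) (hr : 0 < r)
    (dX dY : measure_display) (X : measurableType dX) (Y : measurableType dY)
    (mu : {measure set X -> \bar R}) (nu : {measure set Y -> \bar R})
    (F : X -> 'rV[K]_n) (G : Y -> 'rV[K]_n)
    (mF : measurable_fun setT (F : X -> borel_space abs n))
    (mG : measurable_fun setT (G : Y -> borel_space abs n))
    (hF : forall i : 'I_n, L1 abs mu (fun x => F x ord0 i))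
    (hG : forall i : 'I_n, L1 abs nu (fun y => G y ord0 i))
    (* the two integrals are equal as real numbers, hence finite *)
    (hfin : forall v : 'rV[K]_n,
      (\int[mu]_x (abs (1 + \sum_(i < n) v ord0 i * F x ord0 i) `^ ratr r)%:E
         < +oo)%E)
    (hint : forall v : 'rV[K]_n,
      (\int[mu]_x (abs (1 + \sum_(i < n) v ord0 i * F x ord0 i) `^ ratr r)%:E
       = \int[nu]_y (abs (1 + \sum_(i < n) v ord0 i * G y ord0 i) `^ ratr r)%:E)%E) :
  equimeasurable mu nu (F : X -> borel_space abs n) (G : Y -> borel_space abs n).
Proof.
have [pi pi01 piM] := padic_uniformizer hK; have [pi0 pi1] := andP pi01.
have [D dD] := padic_separable hK.
have repP := padic_residue_system hK pi01 piM.
set s := ratr r in hfin hint.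
have s0 : 0 < s by rewrite ltr0q.
have scaled d (Z : measurableType d) (m : {measure set Z -> \bar R})
    (H : Z -> 'rV[K]_n) (mH : measurable_fun setT (H : Z -> borel_space abs n))
    t v : t != 0 -> affine_moment abs m H s t v =
      ((abs t `^ s)%:E * affine_moment abs m H s 1 (t^-1 *: v))%E.
  move=> t0; have := affine_momentZ m s mH t 1 (t^-1 *: v).
  by rewrite mulr1 scalerA mulfV// scale1r.
(* The hypothesis at v = 0 bounds the total mass. *)
have finmu : (mu setT < +oo)%E.
  by rewrite -(affine_moment10 abs mu F s); exact: hfin.
have munu : mu setT = nu setT.
  rewrite -(affine_moment10 abs mu F s) -(affine_moment10 abs nu G s).
  exact: hint.
have finnu : (nu setT < +oo)%E by rewrite -munu.
have eq1 t v : t != 0 ->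
    affine_moment abs mu F s t v = affine_moment abs nu G s t v.
  move=> t0; rewrite (scaled _ _ mu F)// (scaled _ _ nu G)//.
  by congr (_ * _)%E; exact: hint.
have eqm t v : affine_moment abs mu F s t v = affine_moment abs nu G s t v.
  have [->|] := eqVneq t 0; last exact: eq1.
  apply/le_anti/andP; split; apply: (affine_moment0_le pi01) => // t' t0.
    exact: eq1.
  exact/esym/eq1.
have aff1 v : (affine_moment abs mu F s 1 v < +oo)%E by exact: hfin.
have affF t v : (affine_moment abs mu F s t v < +oo)%E.
  have [->|t0] := eqVneq t 0.
    (* The constant term 0 is written 1 + (-1). *)
    have := affine_momentD_le mu mF 1 (- 1) v s0.
    rewrite subrr absvN absv1 powR1 mul1e => /le_lt_trans; apply.
    exact: lte_add_pinfty.
  by rewrite (scaled _ _ mu F)// lte_mul_pinfty// lee_fin powR_ge0.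
have affG t v : (affine_moment abs nu G s t v < +oo)%E by rewrite -eqm.
have finG a c := max_moment_fin mG a c affG.
have finF a c := max_moment_fin mF a c affF.
have maxE k c : max_moment abs mu F s (abs pi ^+ k) c =
    max_moment abs nu G s (abs pi ^+ k) c.
  have pik : pi ^+ k != 0 by rewrite expf_neq0// -(absv_gt0 abs).
  rewrite -absvX; apply/le_anti/andP; split.
    exact: (max_moment_le pi01).
  exact: (max_moment_le pi01).
have discE (c : 'rV[K]_n) k :
    mu (F @^-1` polydisc (abs := abs) c (abs pi ^+ k.+1)) =
    nu (G @^-1` polydisc (abs := abs) c (abs pi ^+ k.+1)).
  have := maxE k c; rewrite (max_moment_polydisc mu k c s0 pi01 piM mF).
  rewrite (max_moment_polydisc nu k c s0 pi01 piM mG) maxE.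
  set b := (_ - _ : R).
  have b0 : b != 0.
    rewrite gt_eqF// subr_gt0 gt0_ltr_powR ?nnegrE ?exprn_ge0 ?(ltW pi0)//.
    by rewrite exprS gtr_pMl// exprn_gt0.
  have M0 : (max_moment abs nu G s (abs pi ^+ k.+1) c) \is a fin_num.
    by rewrite -absvX ge0_fin_numE ?max_moment_ge0.
  (* The moment for k + 1 is finite and [b] is nonzero, so both can be removed from the equation in
     the extended reals. *)
  move=> /(congr1 (fun z => z - max_moment abs nu G s (abs pi ^+ k.+1) c)%E).
  rewrite ![(max_moment _ _ _ _ _ _ + _)%E]addeC !addeK//.
  move=> /(congr1 (fun z => b^-1%:E * z)%E).
  by rewrite !muleA -!EFinM !mulVf// !mul1e.
pose disc := [set A : set (borel_space abs n) |
  exists (c : 'rV[K]_n) k, A = polydisc (abs := abs) c (abs pi ^+ k.+1)].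
(* The empty set accounts for disjoint polydiscs in the stability under intersection; the whole
   space, of finite mass, is the exhausting sequence for uniqueness of measures. *)
pose gen := disc `|` [set set0; setT].
have odisc (c : 'rV[K]_n) k : open (polydisc (abs := abs) c (abs pi ^+ k.+1)).
  by apply: open_polydisc; exact: exprn_gt0.
have genI : setI_closed gen.
  have gsub A B : gen A -> A `&` B = set0 \/ A `&` B = A -> gen (A `&` B).
    by move=> gA [->|->//]; right; left.
  move=> A B gA gB.
  case: (gA) => [[c [k AE]]|[->|->]]; last first.
  - by rewrite setTI.
  - by rewrite set0I; right; left.
  case: (gB) => [[c' [k' BE]]|[->|->]]; last first.
  - by rewrite setIT.
  - by rewrite setI0; right; left.
  have [kk|/ltW kk] := leP (abs pi ^+ k.+1) (abs pi ^+ k'.+1).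
    by apply: gsub => //; rewrite AE BE; exact: polydisc_nested.
  by rewrite setIC; apply: gsub => //; rewrite AE BE; exact: polydisc_nested.
have genE : @measurable _ (borel_space abs n) `<=` <<s gen >>.
  apply: (@borel_polydisc _ _ _ _ (fun k => abs pi ^+ k.+1) D) => //.
  - by move=> k; exact: exprn_gt0.
  - move=> e e0; have [N Ne] := @exprn_small R (abs pi) e ltac:(lra) e0.
    exists N; apply: le_lt_trans Ne.
    by rewrite exprS ler_piMl ?exprn_ge0 ?(ltW pi0) ?(ltW pi1).
  - by move=> c k; left; exists c, k.
move=> C mC.
apply: (g_sigma_algebra_measure_unique gen _ (fun=> setT)) (genE _ mC) => //.
- move=> _ [[c [k ->]]|[->|->]]; [|exact: measurable0|exact: measurableT].
  by apply: sub_sigma_algebra; exact: odisc.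
- by move=> _; right; right.
- by apply: bigcup_const; exists 0%N.
- move=> _ [[c [k ->]]|[->|->]]; first exact: discE.
    by rewrite !measure0.
  exact: munu.
Qed.
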